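(* Let $\mathbb{T}$ be a time scale, let $a,b,c\in\mathbb{T}$ with $a<b<c$, and let $\Box\in\{\Delta,\nabla\}$. If $f$ is a bounded real function on $[a,c]_{\mathbb{T}}$ and $g$ is a (strictly) monotonically increasing real function on $[a,c]_{\mathbb{T}}$, then $$\int_a^c f\,\Box g=\int_a^b f\,\Box g+\int_b^c f\,\Box g .$$
   Context: A time scale $\mathbb{T}$ is a nonempty closed subset of $\mathbb{R}$. The jump operators are $\sigma(t)=\inf\{s\in\mathbb{T}: s>t\}$ and $\rho(t)=\sup\{s\in\mathbb{T}: s<t\}$ (with $\sigma(\max\mathbb{T})=\max\mathbb{T}$, $\rho(\min\mathbb{T})=\min\mathbb{T}$ when these exist). For $a<b$ in $\mathbb{T}$: $[a,b]_{\mathbb{T}}=[a,b]\cap\mathbb{T}$, $[a,b]_{\Delta}=[a,\rho(b)]_{\mathbb{T}}$, $[a,b]_{\nabla}=[\sigma(a),b]_{\mathbb{T}}$. The symbol $\Box$ stands for $\Delta$ or $\nabla$, the same choice throughout. $\mathcal{P}(I)$ is the set of partitions of $I=[a,b]_{\mathbb{T}}$, i.e. finite sets $P=\{t_0,\ldots,t_n\}\subset I$ with $a=t_0<\cdots<t_n=b$. For $f$ bounded and $g$ strictly increasing on $I$ and $P\in\mathcal{P}(I)$ put $\Delta g_j=g(t_j)-g(t_{j-1})$, $I_{\Box j}=[t_{j-1},t_j]_{\Box}$, $m_{\Box j}=\inf_{I_{\Box j}}f$, $M_{\Box j}=\sup_{I_{\Box j}}f$, and $$U_{\Box}(P,f,g)=\sum_{j=1}^n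 M_{\Box j}\Delta g_j,\qquad L_{\Box}(P,f,g)=\sum_{j=1}^n m_{\Box j}\Delta g_j .$$ The upper and lower Darboux-Stieltjes $\Box$-integrals are $\overline{\int_a^b}f\,\Box g=\inf_{P\in\mathcal{P}(I)}U_{\Box}(P,f,g)$ and $\underline{\int_a^b}f\,\Box g=\sup_{P\in\mathcal{P}(I)}L_{\Box}(P,f,g)$. If they are equal, $f$ is called Riemann-Stieltjes $\Box$-integrable with respect to $g$ on $I$; the symbol $\int_a^b f\,\Box g$ denotes the common value and is defined only in that case. *)

(* Defs.v *)
From mathcomp Require Export all_boot all_order all_algebra.
From mathcomp Require Export all_classical all_reals all_analysis.
Export Order.TTheory GRing.Theory Num.Theory.
Export numFieldNormedType.Exports.

Set Implicit Arguments.
Unset Strict Implicit.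
Unset Printing Implicit Defensive.

Local Open Scope classical_set_scope.
Local Open Scope ring_scope.

Definition is_time_scale (R : realType) (T : set R) : Prop :=
  closed T /\ T !=set0.

(* The case distinctions keep [inf] and [sup] away from the empty set (where
   the library gives them the value 0), so that sigma (max T) = max T and
   rho (min T) = min T. *)
Definition sigma (R : realType) (T : set R) (t : R) : R :=
  let A := [set s | T s /\ t < s] in
  if `[< A !=set0 >] then inf A else t.

Definition rho (R : realType) (T : set R) (t : R) : R :=
  let A := [set s | T s /\ s < t] in
  if `[< A !=set0 >] then sup A else t.

Inductive box := Delta | Nabla.

Definition ts_itv (R : realType) (T : set R) (a b : R) : set R :=
  T `&` `[a, b].

Definition box_itv (B : box) (R : realType) (T : set R) (a b : R) : set R :=
  match B with
  | Delta => ts_itv T a (rho T b)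
  | Nabla => ts_itv T (sigma T a) b
  end.

(* As in the library's [itv_partition], the partition a = t_0 < ... < t_n = b
   is represented by the sequence [:: t_1; ...; t_n], without t_0. *)
Definition ts_partition (R : realType) (T : set R) (a b : R) : set (seq R) :=
  [set P | itv_partition a b P /\ forall t, t \in a :: P -> ts_itv T a b t].

(* In the two sums below the index j runs from 0, so that t_(j+1) is
   [nth b P j] and t_j is [nth b (a :: P) j]. *)
Definition upper_sum (B : box) (R : realType) (T : set R) (a b : R)
    (f g : R -> R) (P : seq R) : R :=
  \sum_(0 <= j < size P)
    sup (f @` box_itv B T (nth b (a :: P) j) (nth b P j)) *
    (g (nth b P j) - g (nth b (a :: P) j)).

Definition lower_sum (B : box) (R : realType) (T : set R) (a b : R)
    (f g : R -> R) (P : seq R) : R :=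
  \sum_(0 <= j < size P)
    inf (f @` box_itv B T (nth b (a :: P) j) (nth b P j)) *
    (g (nth b P j) - g (nth b (a :: P) j)).

Definition upper_integral (B : box) (R : realType) (T : set R) (a b : R)
    (f g : R -> R) : R :=
  inf (upper_sum B T a b f g @` ts_partition T a b).

Definition lower_integral (B : box) (R : realType) (T : set R) (a b : R)
    (f g : R -> R) : R :=
  sup (lower_sum B T a b f g @` ts_partition T a b).

Definition RS_integrable (B : box) (R : realType) (T : set R) (a b : R)
    (f g : R -> R) : Prop :=
  lower_integral B T a b f g = upper_integral B T a b f g.

(* The common value of the two integrals; meaningful only together with
   [RS_integrable B T a b f g]. *)
Definition RS_integral (B : box) (R : realType) (T : set R) (a b : R)
    (f g : R -> R) : R :=
  upper_integral B T a b f g.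

(* Main.v *)
Require Import Defs.
From mathcomp Require Import lra.

Local Open Scope classical_set_scope.
Local Open Scope ring_scope.

(** The lower integral of f is minus the upper integral of -f, so everything
    can be said about upper integrals alone.  Both upper integrals are of the
    form inf_P S(w, P), where S(w, P) is the sum of an interval function w over
    the consecutive pairs of points of P; here
    w x y = (sup of f, resp. -f, over the box [x, y]) * (g y - g x).

    Two properties of w are used.  Splitting [x, z] at a point y of the time
    scale does not increase the sum: w x y + w y z <= w x z.  And if w, w' come
    from f and -f, then 0 <= w + w', since sup f + sup (-f) >= 0.  Splitting
    shows that a partition of [a, c] may be broken at b into partitions of
    [a, b] and [b, c] at no cost ([ts_partition_split]); as partitions can also
    be concatenated, the upper integral over [a, c] is always the sum of those
    over [a, b] and [b, c] ([darboux_infD]).  Splitting a partition Q at the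
    points of another one P shows that S(w, P) + S(w', Q) >= 0, so the infima
    are finite and the defect, upper minus lower integral, is nonnegative
    ([darboux_inf_compl]).

    Hence the defect over [a, c] is the sum of two nonnegative defects, and
    vanishes if and only if both do; that is the equivalence of integrability,
    and the formula for the integral is the additivity of upper integrals. *)

(** * Partitions *)

Section Partition.
Context {R : realType} {T : set R}.
Implicit Types (a b c x : R) (P : seq R).

Lemma ts_partition_nil a : T a -> ts_partition T a a [::].
Proof.
move=> Ta; split; first by split.
by move=> t; rewrite inE => /eqP ->; split => //=; rewrite in_itv /= lexx.
Qed.

(** This characterization is what all inductions on a partition go through:
    the part to the right of the first division point is again a partition. *)
Lemma ts_partition_cons {a x b P} :
  ts_partition T a b (x :: P) <-> [/\ T a, a < x, x <= b & ts_partition T x b P].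
Proof.
split=> [[[/= /andP[ax xP] lP] h]|[Ta ax xb [[xP lP] h]]].
  have [Ta _] : ts_itv T a b a by apply: h; rewrite inE eqxx.
  have [Tx] : ts_itv T a b x by apply: h; rewrite !inE eqxx orbT.
  rewrite /= in_itv /= => /andP[_ xb].
  split=> //; split=> // t tP.
  have [Tt] : ts_itv T a b t by apply: h; rewrite inE tP orbT.
  rewrite /= in_itv /= => /andP[_ tb]; split=> //=; rewrite in_itv /= tb andbT.
  move: tP; rewrite inE => /predU1P[->//|tP].
  by apply/ltW; move: xP; rewrite lt_path_sortedE => /andP[/allP/(_ _ tP)].
split; first by split=> //=; rewrite ax.
move=> t; rewrite inE => /predU1P[->|/h[Tt]].
  by split=> //=; rewrite in_itv /= lexx (le_trans (ltW ax)).
rewrite /= !in_itv /= => /andP[xt tb]; split=> //=.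
by rewrite in_itv /= tb (le_trans (ltW ax)).
Qed.

Lemma ts_partition1 a b : T a -> T b -> a < b -> ts_partition T a b [:: b].
Proof.
move=> Ta Tb ab; apply/ts_partition_cons.
by split=> //; exact: ts_partition_nil.
Qed.

Lemma ts_partition_ends a b P : ts_partition T a b P -> [/\ T a, T b & a <= b].
Proof.
elim: P a => [|x P IH] a.
  move=> [[_ /eqP /= <-] h].
  by have [Ta _] : ts_itv T a a a by apply: h; rewrite inE.
by move=> /ts_partition_cons[Ta ax xb /IH[_ Tb _]]; rewrite (le_trans (ltW ax)).
Qed.

Lemma ts_partition_cat a b c P1 P2 :
  ts_partition T a b P1 -> ts_partition T b c P2 -> ts_partition T a c (P1 ++ P2).
Proof.
move=> + P2bc; have [_ _ bc] := ts_partition_ends _ _ _ P2bc.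
elim: P1 a => [|x P1 IH] a; first by move=> [/itv_partition_nil ->].
move=> /ts_partition_cons[Ta ax xb /IH xc].
by apply/ts_partition_cons; split=> //; exact: le_trans bc.
Qed.

End Partition.

(** * Sums of interval functions over partitions *)

Section IntervalSum.
Context {R : realType}.
Implicit Types (a b c x y z : R) (P Q : seq R) (T : set R) (w : R -> R -> R).

Fixpoint interval_sum w x P : R :=
  if P is y :: P' then w x y + interval_sum w y P' else 0.

Lemma interval_sumE w d x P :
  \sum_(0 <= j < size P) w (nth d (x :: P) j) (nth d P j) = interval_sum w x P.
Proof.
by elim: P x => [|y P IH] x /=; rewrite ?big_nil // big_nat_recl //= -IH.
Qed.

Lemma interval_sum_cat w a b P1 P2 : last a P1 = b ->
  interval_sum w a (P1 ++ P2) = interval_sum w a P1 + interval_sum w b P2.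
Proof.
by elim: P1 a => [|x P1 IH] a /= => [->|/IH ->]; rewrite ?add0r ?addrA.
Qed.

(** The interval function behind an upper sum has this property; the bounds a
    and c are there because f and g are controlled on [a, c] alone. *)
Definition decreases_by_splitting T a c w := forall x y z,
  T x -> T y -> T z -> a <= x -> x < y -> y < z -> z <= c ->
  w x y + w y z <= w x z.

(** With w' the interval function of -f, the sums of - w' are the lower sums
    that belong to the upper sums of w. *)
Definition complementary T a c w w' := forall x y,
  T x -> T y -> a <= x -> x < y -> y <= c -> 0 <= w x y + w' x y.

Lemma decreases_by_splitting_sub {T a c w} a' c' : a <= a' -> c' <= c ->
  decreases_by_splitting T a c w -> decreases_by_splitting T a' c' w.
Proof.
move=> aa' cc' w_dec x y z Tx Ty Tz ax xy yz zc.
by apply: w_dec => //; [exact: le_trans ax|exact: le_trans cc'].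
Qed.

Lemma complementary_sub {T a c w w'} a' c' : a <= a' -> c' <= c ->
  complementary T a c w w' -> complementary T a' c' w w'.
Proof.
move=> aa' cc' ww' x y Tx Ty ax xy yc.
by apply: ww' => //; [exact: le_trans ax|exact: le_trans cc'].
Qed.

Lemma complementaryC {T a c w w'} :
  complementary T a c w w' -> complementary T a c w' w.
Proof. by move=> ww' x y *; rewrite addrC ww'. Qed.

(** When b is not a division point of P, it is inserted, and the only interval
    that changes is the one that contains b. *)
Lemma ts_partition_split {T w a b c P} : decreases_by_splitting T a c w ->
  T b -> a < b -> b < c -> ts_partition T a c P ->
  exists P1 P2, [/\ ts_partition T a b P1, ts_partition T b c P2 &
    interval_sum w a P1 + interval_sum w b P2 <= interval_sum w a P].
Proof.
move=> + Tb + bc; elim: P a => [|y P IH] a w_dec ab.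
  by move=> [/itv_partition_nil ac]; move: bc; rewrite -ac ltNge ltW.
move=> /ts_partition_cons[Ta ay yc yP].
have [Ty _ _] := ts_partition_ends _ _ _ yP.
case: (ltgtP b y) => [by_|yb|eby].
- exists [:: b], (y :: P); split; first exact: ts_partition1.
    by apply/ts_partition_cons.
  by rewrite /= addr0 addrA lerD2r w_dec.
- have [|P1 [P2 [yP1 bP2 le12]]] := IH y _ yb yP.
    exact: decreases_by_splitting_sub (ltW ay) (lexx c) w_dec.
  exists (y :: P1), P2; split=> //; last by rewrite /= -addrA lerD2l.
  by apply/ts_partition_cons; rewrite (ltW yb).
- subst y; exists [:: b], P; split=> //=; first exact: ts_partition1.
  by rewrite addr0.
Qed.

Lemma interval_sum_le {T w a c P} : decreases_by_splitting T a c w ->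
  a < c -> ts_partition T a c P -> interval_sum w a P <= w a c.
Proof.
elim: P a => [|y P IH] a w_dec ac.
  by move=> [/itv_partition_nil eac]; move: ac; rewrite eac ltxx.
move=> /ts_partition_cons[Ta ay yc yP].
have [Ty Tc _] := ts_partition_ends _ _ _ yP.
move: yc; rewrite le_eqVlt => /predU1P[eyc|yc].
  subst y; case: P yP {IH} => [|z P]; first by rewrite /= addr0.
  by move=> /ts_partition_cons[_ /lt_le_trans/[apply]]; rewrite ltxx.
apply: le_trans (w_dec a y c Ta Ty Tc (lexx a) ay yc (lexx c)).
rewrite /= lerD2l IH //.
exact: decreases_by_splitting_sub (ltW ay) (lexx c) w_dec.
Qed.

Lemma interval_sum_compl_same {T w w' a c P} : complementary T a c w w' ->
  ts_partition T a c P -> 0 <= interval_sum w a P + interval_sum w' a P.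
Proof.
elim: P a => [|y P IH] a ww'; first by rewrite /= addr0.
move=> /ts_partition_cons[Ta ay yc yP].
have [Ty _ _] := ts_partition_ends _ _ _ yP.
rewrite /= addrACA addr_ge0 ?ww' // IH //.
exact: complementary_sub (ltW ay) (lexx c) ww'.
Qed.

(** A lower sum does not exceed an upper sum, even over different partitions.
    Splitting Q at the first point y of P leaves an interval [a, y] on which
    the sum of w' is over a partition while that of w is the single term
    w a y; there, w a y dominates the sum of w over the same partition, and
    the two sums over a common partition are compared term by term. *)
Lemma interval_sum_compl {T w w' a c P Q} :
  decreases_by_splitting T a c w -> decreases_by_splitting T a c w' ->
  complementary T a c w w' -> a < c ->
  ts_partition T a c P -> ts_partition T a c Q ->
  0 <= interval_sum w a P + interval_sum w' a Q.
Proof.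
elim: P a Q => [|y P IH] a Q w_dec w'_dec ww' ac.
  by move=> [/itv_partition_nil eac]; move: ac; rewrite eac ltxx.
move=> aP aQ; have /ts_partition_cons[Ta ay yc yP] := aP.
have [Ty _ _] := ts_partition_ends _ _ _ yP.
move: yc; rewrite le_eqVlt => /predU1P[eyc|yc].
  subst y; case: P yP aP {IH} => [_ _ /=|z P].
    rewrite addr0; apply: le_trans (interval_sum_compl_same ww' aQ) _.
    by rewrite lerD2r (interval_sum_le w_dec).
  by move=> /ts_partition_cons[_ /lt_le_trans/[apply]]; rewrite ltxx.
have [Q1 [Q2 [aQ1 yQ2 le12]]] := ts_partition_split w'_dec Ty ay yc aQ.
have w_dec1 := decreases_by_splitting_sub a y (lexx a) (ltW yc) w_dec.
have w_dec2 := decreases_by_splitting_sub y c (ltW ay) (lexx c) w_dec.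
have w'_dec2 := decreases_by_splitting_sub y c (ltW ay) (lexx c) w'_dec.
have ww'1 := complementary_sub a y (lexx a) (ltW yc) ww'.
have ww'2 := complementary_sub y c (ltW ay) (lexx c) ww'.
have := interval_sum_le w_dec1 ay aQ1.
have := interval_sum_compl_same ww'1 aQ1.
have := IH y Q2 w_dec2 w'_dec2 ww'2 yc yP yQ2.
move: le12 => /=; lra.
Qed.

(** * Infima over partitions *)

Definition darboux_inf T w a b : R := inf (interval_sum w a @` ts_partition T a b).

Lemma interval_sums_neq0 {T w a b} : T a -> T b -> a < b ->
  interval_sum w a @` ts_partition T a b !=set0.
Proof.
move=> Ta Tb ab; exists (interval_sum w a [:: b]), [:: b] => //.
exact: ts_partition1.
Qed.

(** The lower sum over the trivial partition is a lower bound. *)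
Lemma interval_sums_has_lbound {T w w' a b} : T a -> T b -> a < b ->
  decreases_by_splitting T a b w -> decreases_by_splitting T a b w' ->
  complementary T a b w w' ->
  has_lbound (interval_sum w a @` ts_partition T a b).
Proof.
move=> Ta Tb ab w_dec w'_dec ww'; exists (- interval_sum w' a [:: b]).
move=> _ [P aP <-]; rewrite lerNl -subr_ge0 opprK addrC.
by apply: interval_sum_compl aP _ => //; exact: ts_partition1.
Qed.

Lemma darboux_inf_compl {T w w' a b} : T a -> T b -> a < b ->
  decreases_by_splitting T a b w -> decreases_by_splitting T a b w' ->
  complementary T a b w w' ->
  0 <= darboux_inf T w a b + darboux_inf T w' a b.
Proof.
move=> Ta Tb ab w_dec w'_dec ww'; rewrite -lerBlDr sub0r.
apply: lb_le_inf => [|_ [P aP <-]]; first exact: interval_sums_neq0.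
rewrite lerNl; apply: lb_le_inf => [|_ [Q aQ <-]]; first exact: interval_sums_neq0.
by rewrite lerNl -subr_ge0 opprK (interval_sum_compl w_dec w'_dec).
Qed.

(** The inequality <= is concatenation of partitions, and >= is splitting at b.
    The complementary function w' provides the lower bounds without which the
    infima would be meaningless. *)
Lemma darboux_infD {T w w' a b c} :
  T a -> T b -> T c -> a < b -> b < c ->
  decreases_by_splitting T a c w -> decreases_by_splitting T a c w' ->
  complementary T a c w w' ->
  darboux_inf T w a c = darboux_inf T w a b + darboux_inf T w b c.
Proof.
move=> Ta Tb Tc ab bc w_dec w'_dec ww'; have ac := lt_trans ab bc.
have lb_sub x y : T x -> T y -> a <= x -> x < y -> y <= c ->
    has_lbound (interval_sum w x @` ts_partition T x y).
  move=> Tx Ty ax xy yc; apply: (@interval_sums_has_lbound T w w') => //.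
  - exact: decreases_by_splitting_sub w_dec.
  - exact: decreases_by_splitting_sub w'_dec.
  - exact: complementary_sub ww'.
apply/eqP; rewrite eq_le; apply/andP; split.
  rewrite -lerBlDr; apply: lb_le_inf => [|_ [P1 P1ab <-]].
    exact: interval_sums_neq0.
  rewrite lerBlDr -lerBlDl; apply: lb_le_inf => [|_ [P2 P2bc <-]].
    exact: interval_sums_neq0.
  rewrite lerBlDl; have [[_ /eqP lP1] _] := P1ab.
  rewrite -(interval_sum_cat _ _ _ _ _ lP1); apply: ge_inf; first exact: lb_sub.
  by exists (P1 ++ P2) => //; exact: ts_partition_cat P2bc.
apply: lb_le_inf => [|_ [P Pac <-]]; first exact: interval_sums_neq0.
have [P1 [P2 [P1ab P2bc le12]]] := ts_partition_split w_dec Tb ab bc Pac.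
apply: le_trans le12; rewrite lerD //.
  by apply: ge_inf; [apply: lb_sub; rewrite ?(ltW bc)|exists P1].
by apply: ge_inf; [apply: lb_sub; rewrite ?(ltW ab)|exists P2].
Qed.

End IntervalSum.

(** * Darboux-Stieltjes sums *)

Section BoxItv.
Context (B : box) {R : realType} {T : set R}.
Implicit Types x y z : R.

Lemma le_sigma {x y} : T y -> x < y -> x <= sigma T x /\ sigma T x <= y.
Proof.
move=> Ty xy; rewrite /sigma; case: asboolP => [A0|[]]; last by exists y.
split; first by apply: lb_le_inf => // s [_ /ltW].
by apply: ge_inf => //; exists x => s [_ /ltW].
Qed.

Lemma rho_le {x y} : T x -> x < y -> x <= rho T y /\ rho T y <= y.
Proof.
move=> Tx xy; rewrite /rho; case: asboolP => [A0|[]]; last by exists x.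
split; last by apply: ge_sup => // s [_ /ltW].
by apply: ub_le_sup => //; exists y => s [_ /ltW].
Qed.

Lemma box_itv_neq0 x y : T x -> T y -> x < y -> box_itv B T x y !=set0.
Proof.
move=> Tx Ty xy; case: B => /=.
  by exists x; split=> //=; rewrite in_itv /= lexx; case: (rho_le Tx xy).
by exists y; split=> //=; rewrite in_itv /= lexx andbT; case: (le_sigma Ty xy).
Qed.

Lemma box_itv_sub x y : T x -> T y -> x < y -> box_itv B T x y `<=` ts_itv T x y.
Proof.
move=> Tx Ty xy.
have [h1 h2] := le_sigma Ty xy; have [h3 h4] := rho_le Tx xy.
case: B => /= s [Ts] /=; rewrite in_itv /= => /andP[xs sy]; split=> //=;
  rewrite in_itv /= ?xs ?sy ?andbT /=.
  exact: le_trans sy h4.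
exact: le_trans h1 xs.
Qed.

Lemma box_itv_subl x y z : T x -> T y -> T z -> x < y -> y < z ->
  box_itv B T x y `<=` box_itv B T x z.
Proof.
move=> Tx Ty Tz xy yz.
have [h1 h2] := rho_le Tx xy; have [h3 h4] := rho_le Ty yz.
case: B => /= s [Ts] /=; rewrite in_itv /= => /andP[xs sy]; split=> //=;
  rewrite in_itv /= xs /=; last exact: le_trans sy (ltW yz).
exact: le_trans sy (le_trans h2 h3).
Qed.

Lemma box_itv_subr x y z : T x -> T y -> T z -> x < y -> y < z ->
  box_itv B T y z `<=` box_itv B T x z.
Proof.
move=> Tx Ty Tz xy yz.
have [h1 h2] := le_sigma Ty xy; have [h3 h4] := le_sigma Tz yz.
case: B => /= s [Ts] /=; rewrite in_itv /= => /andP[ys sz]; split=> //=;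
  rewrite in_itv /= sz andbT; first exact: le_trans (ltW xy) ys.
exact: le_trans h2 (le_trans h3 ys).
Qed.

Definition stieltjes_weight (f g : R -> R) x y : R :=
  sup (f @` box_itv B T x y) * (g y - g x).

Lemma upper_integralE (f g : R -> R) x y :
  upper_integral B T x y f g = darboux_inf T (stieltjes_weight f g) x y.
Proof.
rewrite /upper_integral /darboux_inf; congr inf.
by apply: eq_imagel => P _; rewrite -(interval_sumE _ y).
Qed.

Lemma lower_integralE (f g : R -> R) x y :
  lower_integral B T x y f g = - darboux_inf T (stieltjes_weight (\- f) g) x y.
Proof.
rewrite /lower_integral /darboux_inf /inf opprK image_comp; congr sup.
apply: eq_imagel => P _; rewrite /= -(interval_sumE _ y) -sumrN.
by apply: eq_bigr => j _; rewrite /inf image_comp mulNr.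
Qed.

Section Weight.
Context {a c : R} {f g : R -> R}.
Hypothesis f_ub : has_ubound (f @` ts_itv T a c).
Hypothesis g_incr :
  forall x y, ts_itv T a c x -> ts_itv T a c y -> x < y -> g x < g y.

Lemma stieltjes_incr_ge0 x y : T x -> T y -> a <= x -> x < y -> y <= c ->
  0 <= g y - g x.
Proof.
move=> Tx Ty ax xy yc; rewrite subr_ge0 ltW // g_incr //; split=> //=;
  rewrite in_itv /=; apply/andP; split=> //; [exact: le_trans (ltW xy) yc|].
exact: le_trans ax (ltW xy).
Qed.

Lemma box_image_has_ubound x y : T x -> T y -> a <= x -> x < y -> y <= c ->
  has_ubound (f @` box_itv B T x y).
Proof.
move=> Tx Ty ax xy yc; have [M Mub] := f_ub; exists M.
move=> _ [s /(box_itv_sub _ _ Tx Ty xy)[Ts] /itvP sxy <-].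
apply: Mub; exists s => //; split=> //=; rewrite in_itv /=.
by rewrite (le_trans ax) ?(le_trans _ yc) ?sxy.
Qed.

(** On each half the supremum is taken over a subset. *)
Lemma stieltjes_weight_decreases :
  decreases_by_splitting T a c (stieltjes_weight f g).
Proof.
move=> x y z Tx Ty Tz ax xy yz zc; rewrite /stieltjes_weight.
have xz := lt_trans xy yz.
have ub_xz := box_image_has_ubound _ _ Tx Tz ax xz zc.
have sup_mono u v : T u -> T v -> u < v ->
    box_itv B T u v `<=` box_itv B T x z ->
    sup (f @` box_itv B T u v) <= sup (f @` box_itv B T x z).
  move=> Tu Tv uv sub; apply: ge_sup.
    by have [s us] := box_itv_neq0 _ _ Tu Tv uv; exists (f s), s.
  by move=> _ [s us <-]; apply: ub_le_sup => //; exists s => //; exact: sub.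
have -> : g z - g x = (g y - g x) + (g z - g y) by lra.
rewrite [leRHS]mulrDr lerD // ler_wpM2r //.
- by apply: stieltjes_incr_ge0 => //; exact: le_trans (ltW yz) zc.
- by apply: sup_mono => //; exact: box_itv_subl.
- by apply: stieltjes_incr_ge0 => //; exact: le_trans ax (ltW xy).
- by apply: sup_mono => //; exact: box_itv_subr.
Qed.

End Weight.

(** This is sup f + sup (-f) >= f p - f p for any p in the box. *)
Lemma stieltjes_weight_compl {a c} {f g : R -> R} :
  has_ubound (f @` ts_itv T a c) -> has_ubound ((\- f) @` ts_itv T a c) ->
  (forall x y, ts_itv T a c x -> ts_itv T a c y -> x < y -> g x < g y) ->
  complementary T a c (stieltjes_weight f g) (stieltjes_weight (\- f) g).
Proof.
move=> f_ub Nf_ub g_incr x y Tx Ty ax xy yc; rewrite /stieltjes_weight -mulrDl.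
apply: mulr_ge0; last exact: (stieltjes_incr_ge0 g_incr).
have [p xpy] := box_itv_neq0 _ _ Tx Ty xy.
rewrite -(subrr (f p)) lerD //; apply: ub_le_sup; try by exists p.
  exact: (box_image_has_ubound f_ub).
exact: (box_image_has_ubound Nf_ub).
Qed.

End BoxItv.

(** * Additivity of the integral *)

Theorem theorem3p7 (B : box) (R : realType) (T : set R) (a b c : R)
    (f g : R -> R) :
  is_time_scale T ->
  T a -> T b -> T c -> a < b -> b < c ->
  [bounded f x | x in ts_itv T a c] ->
  (forall x y, ts_itv T a c x -> ts_itv T a c y -> x < y -> g x < g y) ->
  (RS_integrable B T a c f g <->
     RS_integrable B T a b f g /\ RS_integrable B T b c f g) /\
  (RS_integrable B T a c f g ->
     RS_integral B T a c f g =
     RS_integral B T a b f g + RS_integral B T b c f g).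
Proof.
move=> _ Ta Tb Tc ab bc f_bdd g_incr.
have aI : ts_itv T a c a.
  by split=> //=; rewrite in_itv /= lexx ltW // (lt_trans ab).
have [M fM] := (@ex_bound _ _ _ f _ (globally_properfilter aI)).1 f_bdd.
have f_ub : has_ubound (f @` ts_itv T a c).
  by exists M => _ [x /fM /= fx <-]; exact: le_trans (ler_norm _) fx.
have Nf_ub : has_ubound ((\- f) @` ts_itv T a c).
  by exists M => _ [x /fM /= fx <-]; rewrite lerNl lerNnormlW.
have w_dec := stieltjes_weight_decreases B f_ub g_incr.
have w'_dec := stieltjes_weight_decreases B Nf_ub g_incr.
have ww' := stieltjes_weight_compl B f_ub Nf_ub g_incr.
have upperD := darboux_infD Ta Tb Tc ab bc w_dec w'_dec ww'.
have lowerD := darboux_infD Ta Tb Tc ab bc w'_dec w_dec (complementaryC ww').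
have defect_ab := darboux_inf_compl Ta Tb ab
  (decreases_by_splitting_sub a b (lexx a) (ltW bc) w_dec)
  (decreases_by_splitting_sub a b (lexx a) (ltW bc) w'_dec)
  (complementary_sub a b (lexx a) (ltW bc) ww').
have defect_bc := darboux_inf_compl Tb Tc bc
  (decreases_by_splitting_sub b c (ltW ab) (lexx c) w_dec)
  (decreases_by_splitting_sub b c (ltW ab) (lexx c) w'_dec)
  (complementary_sub b c (ltW ab) (lexx c) ww').
rewrite /RS_integral /RS_integrable !upper_integralE !lower_integralE.
rewrite upperD lowerD; split=> //; split=> [?|[? ?]]; last lra.
by split; lra.
Qed.
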